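(* Let $G$ be a finite non-cyclic nilpotent group which is not a $p$-group for any prime $p$. Then $\mathcal{D}(G)$ is connected. In particular, $\diam(\mathcal{D}(G))=2$ if $\exp(G)$ is a square-free number; $\diam(\mathcal{D}(G))=4$ if $G$ is a $\Psi$-group; and $\diam(\mathcal{D}(G))=3$ otherwise.
   Context: The exponent $\exp(G)$ is the least common multiple of the orders of the elements of $G$. The power graph $\mathcal{P}(G)$ of a finite group $G$ is the simple graph with vertex set $G$ in which two distinct vertices are adjacent if one is a power of the other. The enhanced power graph $\mathcal{P}_E(G)$ is the simple graph with vertex set $G$ in which two distinct vertices $x,y$ are adjacent if $\langle x,y\rangle$ is cyclic. The difference graph $\mathcal{D}(G)$ is obtained from $\mathcal{P}_E(G)-\mathcal{P}(G)$ (vertex set $G$, edges those of $\mathcal{P}_E(G)$ that are not edges of $\mathcal{P}(G)$) by removing all isolated vertices. Here $\diam(\Gamma)$ denotes the diameter of a graph $\Gamma$, the greatest distance between two of its vertices. A maximal cyclic subgroup of a group $P$ is a cyclic subgroup not properly contained in another cyclic subgroup of $P$. A finite non-cyclic nilpotent group $G$ which is not a $p$-group is called a $\Psi$-group if, for some prime $p$, with $P$ the Sylow $p$-subgroup of $G$, there are two distinct cyclic subgroups $\langle u\rangle,\langle v\rangle\le P$ with $o(u)=o(v)$, neither of which is a maximal cyclic subgroup of $P$. Here $o(g)$ is the order of $g$. *)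

(* Defs.v *)
From mathcomp Require Import all_boot all_fingroup all_solvable.

Set Implicit Arguments.
Unset Strict Implicit.
Unset Printing Implicit Defensive.

Local Open Scope group_scope.

Section SimpleGraphs.

Variable T : finType.

Record sgraph := SGraph {
  vset : {set T};
  adj : rel T;
  adj_sym : symmetric adj;
  adj_irr : irreflexive adj;
  adj_vset : forall x y, adj x y -> x \in vset
}.

Implicit Types (g h : sgraph) (x y : T).

Lemma diffE_sym g h : symmetric [rel x y | adj g x y && ~~ adj h x y].
Proof. by move=> x y /=; rewrite adj_sym (adj_sym h). Qed.

Lemma diffE_irr g h : irreflexive [rel x y | adj g x y && ~~ adj h x y].
Proof. by move=> x /=; rewrite adj_irr. Qed.

Lemma diffE_vset g h x y :
  [rel x y | adj g x y && ~~ adj h x y] x y -> x \in vset g.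
Proof. by move=> /= /andP[/adj_vset]. Qed.

Definition diffE g h : sgraph :=
  SGraph (diffE_sym g h) (diffE_irr g h) (@diffE_vset g h).

Definition isolated g x : bool := [forall y, ~~ adj g x y].

Lemma rem_isolated_vset g x y :
  adj g x y -> x \in [set x in vset g | ~~ isolated g x].
Proof.
move=> gxy; rewrite inE (adj_vset gxy) /= negb_forall.
by apply/existsP; exists y; rewrite negbK.
Qed.

(* Removing isolated vertices leaves the edge set unchanged. *)
Definition rem_isolated g : sgraph :=
  SGraph (@adj_sym g) (@adj_irr g) (@rem_isolated_vset g).

Definition connected_graph g : Prop :=
  vset g != set0 /\ {in vset g &, forall x y, connect (adj g) x y}.

Definition walk g (n : nat) x y : bool :=
  [exists p : n.-tuple T, path (adj g) x p && (last x p == y)].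

(* Length of a shortest walk from x to y. When y is reachable from x this     *)
(* length is less than #|T|; otherwise the value is #|T|.                     *)
Definition gdist g x y : nat :=
  find (fun n => walk g n x y) (iota 0 #|T|).

Definition diam g : nat := \max_(x in vset g) \max_(y in vset g) gdist g x y.

End SimpleGraphs.

Section GroupGraphs.

Variables (gT : finGroupType) (G : {group gT}).

Definition power_adj : rel gT := [rel x y |
  [&& x \in G, y \in G, x != y & (x \in <[y]>) || (y \in <[x]>)]].

Lemma power_adj_sym : symmetric power_adj.
Proof.
by move=> x y; rewrite /power_adj /= (eq_sym x) [(x \in <[_]>) || _]orbC andbCA.
Qed.

Lemma power_adj_irr : irreflexive power_adj.
Proof. by move=> x; rewrite /power_adj /= eqxx !andbF. Qed.

Lemma power_adj_vset x y : power_adj x y -> x \in (G : {set gT}).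
Proof. by case/and4P. Qed.

Definition power_graph : sgraph gT :=
  SGraph power_adj_sym power_adj_irr power_adj_vset.

Definition epower_adj : rel gT := [rel x y |
  [&& x \in G, y \in G, x != y & cyclic <<[set x; y]>>]].

Lemma epower_adj_sym : symmetric epower_adj.
Proof. by move=> x y; rewrite /epower_adj /= (eq_sym x) setUC andbCA. Qed.

Lemma epower_adj_irr : irreflexive epower_adj.
Proof. by move=> x; rewrite /epower_adj /= eqxx !andbF. Qed.

Lemma epower_adj_vset x y : epower_adj x y -> x \in (G : {set gT}).
Proof. by case/and4P. Qed.

Definition enhanced_power_graph : sgraph gT :=
  SGraph epower_adj_sym epower_adj_irr epower_adj_vset.

Definition difference_graph : sgraph gT :=
  rem_isolated (diffE enhanced_power_graph power_graph).

End GroupGraphs.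

Definition square_free (n : nat) : Prop := forall d : nat, (d ^ 2 %| n)%N -> d = 1%N.

Section PsiGroups.

Variable gT : finGroupType.
Implicit Types G P : {group gT}.

Definition not_pgroup G : Prop := forall p : nat, prime p -> ~~ p.-group G.

Definition max_cyclic P (C : {set gT}) : bool :=
  [max C of H | (H \subset P) && cyclic H].

Definition Psi_group G : Prop :=
  [/\ nilpotent G, ~~ cyclic G, not_pgroup G
    & exists (p : nat) (P : {group gT}) (u v : gT),
        [/\ prime p, p.-Sylow(G) P & u \in P] /\
        [/\ v \in P, <[u]> != <[v]>, #[u] = #[v],
            ~~ max_cyclic P <[u]> & ~~ max_cyclic P <[v]>]].

End PsiGroups.

(* Main.v *)
(* Adjacency in the difference graph can be tested on primary parts: x and y
   are adjacent iff for each prime r the subgroups <[x.`_r]> and <[y.`_r]> are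
   comparable, strictly in one direction for some r and strictly in the other
   for some r. Hence every vertex x is adjacent to a primary element a, namely a
   p-element with <[x.`_p]> properly contained in <[a]>. Nontrivial elements of
   coprime orders are adjacent, so two such primary elements can be joined in
   one step if their primes differ and in two steps otherwise; this gives
   distance at most 4. If G is not a Psi-group and the primes agree, then
   <[x.`_p]> and <[y.`_p]> are non-maximal, hence comparable, and the larger of
   the two primary elements is a common neighbour. In the square-free case a
   common neighbour is found by comparing the sets of primes dividing the orders
   of x and y. The lower bounds are attained by pairs u * m, v * m (4), c * m, c
   with c of order p and a p-th power of a p-element (3), and two elements of a
   Sylow subgroup generating a non-cyclic subgroup (2); here m generates a
   maximal cyclic p'-subgroup. *)
Require Import Defs.
From mathcomp Require Import all_boot all_fingroup all_solvable.

Set Implicit Arguments.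
Unset Strict Implicit.
Unset Printing Implicit Defensive.

Local Open Scope group_scope.

(** * Walks, distance and diameter in finite graphs *)

Section Graphs.

Variable T : finType.
Implicit Types (g : sgraph T) (x y : T).

Lemma walk0 g x y : walk g 0 x y = (x == y).
Proof.
apply/existsP/idP => [[p]|/eqP->]; first by rewrite tuple0.
by exists [tuple]; rewrite /= eqxx.
Qed.

Lemma walkS g n x y : walk g n.+1 x y = [exists z, adj g x z && walk g n z y].
Proof.
apply/existsP/existsP => [[p]|[z /andP[gxz /existsP[p gzp]]]].
  case/tupleP: p => z p /= /andP[/andP[gxz gzp] lzp]; exists z; rewrite gxz.
  by apply/existsP; exists p; rewrite gzp.
by exists [tuple of z :: p]; rewrite /= gxz.
Qed.

Lemma walk1 g x y : walk g 1 x y = adj g x y.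
Proof.
rewrite walkS; apply/existsP/idP => [[z]|gxy].
  by rewrite walk0 => /andP[gxz /eqP<-].
by exists y; rewrite gxy walk0 eqxx.
Qed.

Lemma walk_cons g n z x y : adj g x z -> walk g n z y -> walk g n.+1 x y.
Proof.
by move=> gxz gzy; rewrite walkS; apply/existsP; exists z; rewrite gxz.
Qed.

Lemma walk2 g x z y : adj g x z -> adj g z y -> walk g 2 x y.
Proof. by move=> gxz gzy; apply: walk_cons gxz _; rewrite walk1. Qed.

Lemma walk3 g x a b y : adj g x a -> adj g a b -> adj g b y -> walk g 3 x y.
Proof. by move=> gxa gab gby; apply: walk_cons gxa (walk2 gab gby). Qed.

Lemma walk2_sym g x y : walk g 2 x y -> walk g 2 y x.
Proof.
rewrite walkS => /existsP[z /andP[gxz]]; rewrite walk1 => gzy.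
by apply: (walk2 (z := z)); rewrite adj_sym.
Qed.

Lemma gdist_le g n x y : walk g n x y -> gdist g x y <= n.
Proof.
move=> wn; rewrite /gdist leqNgt; apply/negP => lt_n.
have := before_find 0 lt_n; rewrite nth_iota ?wn //.
by rewrite -[#|T|](size_iota 0); apply: leq_trans lt_n (find_size _ _).
Qed.

(** The hypothesis [n <= #|T|] matters because an unsuccessful search gives [gdist] the value
    [#|T|]. *)
Lemma gdist_ge g n x y :
  n <= #|T| -> (forall k, k < n -> ~~ walk g k x y) -> n <= gdist g x y.
Proof.
move=> leT nw; rewrite leqNgt; apply/negP => lt_n.
have lt_T : gdist g x y < #|T| := leq_trans lt_n leT.
have hw : has (fun k => walk g k x y) (iota 0 #|T|).
  by rewrite has_find size_iota.
by have := nth_find 0 hw; rewrite nth_iota // (negPf (nw _ lt_n)).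
Qed.

Lemma walk_connect g n x y : walk g n x y -> connect (adj g) x y.
Proof.
by case/existsP=> p /andP[gxp /eqP eq_y]; apply/connectP; exists p.
Qed.

Lemma diam_le g n :
  {in vset g &, forall x y, exists2 k, k <= n & walk g k x y} -> diam g <= n.
Proof.
move=> wn; apply/bigmax_leqP => x gx; apply/bigmax_leqP => y gy.
by have [k le_kn wk] := wn x y gx gy; apply: leq_trans (gdist_le wk) le_kn.
Qed.

Lemma diam_ge g n x y :
  n <= #|T| -> x \in vset g -> y \in vset g ->
  (forall k, k < n -> ~~ walk g k x y) -> n <= diam g.
Proof.
move=> leT gx gy /(gdist_ge leT) le_n.
by apply: (bigmax_sup x) => //; apply: (bigmax_sup y).
Qed.

End Graphs.

(** * Cyclic subgroups and primary parts of elements *)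

Section Cyclic.

Variable gT : finGroupType.
Implicit Types (G H : {group gT}) (x y z t a b c : gT) (p : nat).

Lemma cyclic_pairP x y :
  reflect (exists2 t, x \in <[t]> & y \in <[t]>) (cyclic <<[set x; y]>>).
Proof.
apply: (iffP cyclicP) => [[t def_t]|[t xt yt]].
  by exists t; rewrite -def_t mem_gen // !inE eqxx ?orbT.
apply/cyclicP/(cyclicS _ (cycle_cyclic t)).
by rewrite gen_subG; apply/subsetP=> z; rewrite !inE => /orP[]/eqP->.
Qed.

(** A cyclic group has one subgroup of each possible order, so inside [<[t]>] divisibility of orders
    gives inclusion. *)
Lemma mem_cycle_dvd t x y :
  x \in <[t]> -> y \in <[t]> -> #[x] %| #[y] -> x \in <[y]>.
Proof.
move=> xt yt; rewrite -cycle_subG -(cardSg_cyclic (cycle_cyclic t)) //=;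
  by rewrite cycle_subG.
Qed.

Lemma p_elt_comparable p t x y :
  x \in <[t]> -> y \in <[t]> -> p.-elt x -> p.-elt y ->
  (x \in <[y]>) || (y \in <[x]>).
Proof.
move=> xt yt /p_natP[m Dx] /p_natP[n Dy].
have [le_mn|/ltnW le_nm] := leqP m n.
  by rewrite (mem_cycle_dvd xt yt) // Dx Dy dvdn_exp2l.
by rewrite (mem_cycle_dvd yt xt) ?orbT // Dx Dy dvdn_exp2l.
Qed.

Lemma mem_cycle_trans H y x : x \in <[y]> -> y \in H -> x \in H.
Proof. by move=> xy; rewrite -cycle_subG => /subsetP->. Qed.

Lemma mem_cycle_constt (pi : nat_pred) x y :
  x \in <[y]> -> x.`_pi \in <[y.`_pi]>.
Proof. by case/cycleP=> n ->; rewrite consttX mem_cycle. Qed.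

Lemma cycle_p_elt (pi : nat_pred) x y : x \in <[y]> -> pi.-elt y -> pi.-elt x.
Proof. by move=> xy piy; apply: mem_p_elt xy. Qed.

Lemma notin_cycle_constt x y :
  x \notin <[y]> -> exists2 p, prime p & x.`_p \notin <[y]>.
Proof.
move=> nxy.
case: (pickP [pred p : 'I_#[x].+1 | x.`_p \notin <[y]>]) => /= [p|allp].
  move=> np; exists (p : nat) => //; apply: contraR np => nprime_p.
  (* At a non-prime index the primary part is trivial, so it cannot escape [<[y]>]. *)
  suff /constt1P->: (p : nat)^'.-elt x by apply: group1.
  rewrite /p_elt p'natEpi ?order_gt0 //.
  by rewrite mem_primes (negPf nprime_p).
case/negP: nxy; rewrite -[x]prod_constt big_mkord group_prod // => p _.
by apply/idPn => np; have /= := allp p; rewrite np.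
Qed.

(** Take a pi-element [m] of largest order: if [<[t]>] contains [m] and [w], the pi-part of [t]
    generates a group containing both, which cannot be larger than [<[m]>]. *)
Lemma max_elt_ex (pi : nat_pred) G : exists m, [/\ m \in G, pi.-elt m &
  forall w, w \in G -> pi.-elt w -> cyclic <<[set m; w]>> -> w \in <[m]>].
Proof.
have P1 : [pred x in G | pi.-elt x] 1 by rewrite /= group1 /p_elt order1.
have [m /= /andP[Gm pi_m] max_m] := arg_maxnP (fun x => #[x]) P1.
exists m; split=> // w Gw pi_w /cyclicP[t def_t].
have [mt wt]: m \in <[t]> /\ w \in <[t]>.
  by rewrite -def_t !mem_gen // !inE eqxx ?orbT.
have Gt : t \in G.
  rewrite -cycle_subG -def_t gen_subG; apply/subsetP=> z.
  by rewrite !inE => /orP[]/eqP->.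
have := mem_cycle_constt pi mt; rewrite (constt_p_elt pi_m) => mt'.
have := mem_cycle_constt pi wt; rewrite (constt_p_elt pi_w) => wt'.
suff ->: <[m]> = <[t.`_pi]> by [].
apply/eqP; rewrite eqEcard cycle_subG mt'; apply: max_m.
rewrite p_elt_constt andbT.
by apply: mem_cycle_trans Gt; apply: cycle_constt.
Qed.

Lemma eq_cycle_order t x y :
  x \in <[t]> -> y \in <[t]> -> #[x] = #[y] -> <[x]> = <[y]>.
Proof.
move=> xt yt oxy; apply/eqP; rewrite eqEsubset !cycle_subG.
by rewrite (mem_cycle_dvd xt yt) ?(mem_cycle_dvd yt xt) // oxy.
Qed.

Lemma max_cyclicPn (P : {group gT}) u : u \in P ->
  reflect (exists a, [/\ a \in P, u \in <[a]> & a \notin <[u]>])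
          (~~ max_cyclic P <[u]>).
Proof.
move=> Pu; apply: (iffP idP) => [nmax|[a [Pa ua nau]]]; last first.
  apply: contra nau => /maxgroupP[_ /(_ <[a]>%G)] /=.
  by rewrite !cycle_subG Pa cycle_cyclic ua => <- //; apply: cycle_id.
have gPu : (<[u]> \subset P) && cyclic <[u]>.
  by rewrite cycle_subG Pu cycle_cyclic.
have [H maxH sub_uH] :=
  @maxgroup_exists _ (fun H => (H \subset P) && cyclic H) _ gPu.
have /maxgroupP[/andP[sHP /cyclicP[a defH]] _] := maxH.
exists a; split; first by rewrite -cycle_subG -defH.
  by rewrite -defH -cycle_subG.
apply: contra nmax => au; suff eq_uH: <[u]> = H by rewrite /max_cyclic eq_uH.
by apply/eqP; rewrite eqEsubset sub_uH defH cycle_subG.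
Qed.

Lemma prime_order_neq1 p c : prime p -> #[c] = p -> c != 1.
Proof. by move=> /prime_gt1 p_gt1 oc; rewrite -order_gt1 oc. Qed.

Lemma other_prime G p : not_pgroup G -> prime p ->
  exists q c, [/\ prime q, q != p, c \in G & #[c] = q].
Proof.
move=> npG pr_p; have := npG p pr_p; rewrite /pgroup.
rewrite /pnat cardG_gt0 /= => /allPn[q]; rewrite mem_primes.
case/and3P=> pr_q _ q_dv nq; have [c Gc oc] := Cauchy pr_q q_dv.
by exists q, c; split.
Qed.

Lemma coprime_commute G x y : nilpotent G -> x \in G -> y \in G ->
  coprime #[x] #[y] -> commute x y.
Proof.
move=> nilG Gx Gy co_xy; apply/cent1P; rewrite cent1C -cent_cycle -cycle_subG.
by rewrite (sub_nilpotent_cent2 nilG) ?cycle_subG.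
Qed.

Lemma coprime_cycleM G x y : nilpotent G -> x \in G -> y \in G ->
  coprime #[x] #[y] -> x \in <[x * y]> /\ y \in <[x * y]>.
Proof.
move=> nilG Gx Gy co_xy.
have cxy := coprime_commute nilG Gx Gy co_xy.
rewrite cycleM //; split; first exact: subsetP (mulG_subl _ _) _ (cycle_id x).
exact: subsetP (mulG_subr _ _) _ (cycle_id y).
Qed.

Lemma consttM_p (pi : nat_pred) c m :
  commute c m -> pi.-elt c -> pi^'.-elt m ->
  (c * m).`_pi = c /\ (c * m).`_pi^' = m.
Proof.
move=> ccm pi_c pi_m; rewrite !consttM //.
rewrite (constt_p_elt pi_c) (constt1P pi_m) (constt_p_elt pi_m) mulg1.
suff /constt1P->: pi^'^'.-elt c by rewrite mul1g.
by rewrite /p_elt pnatNK.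
Qed.

End Cyclic.

(** * Adjacency and vertices of the difference graph *)

Section DifferenceGraph.

Variables (gT : finGroupType) (G : {group gT}).
Hypotheses (nilG : nilpotent G) (npG : not_pgroup G).
Implicit Types (x y z t a b c m : gT) (p q : nat).

Local Notation D := (adj (difference_graph G)).

Lemma difference_adjP x y :
  reflect [/\ x \in G, y \in G, cyclic <<[set x; y]>>,
              x \notin <[y]> & y \notin <[x]>] (D x y).
Proof.
apply: (iffP andP) => [[/and4P[Gx Gy neq_xy cxy]]|[Gx Gy cxy nxy nyx]].
  by rewrite /= /power_adj /= Gx Gy neq_xy /= negb_or => /andP[].
have neq_xy : x != y by apply: contraNneq nxy => ->; apply: cycle_id.
split; first by apply/and4P.
by rewrite /= /power_adj /= !negb_and negb_or nxy nyx !orbT.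
Qed.

Lemma vertexP x : reflect (exists y, D x y) (x \in vset (difference_graph G)).
Proof.
rewrite inE; apply: (iffP andP) => [[_ /forallPn[y]]|[y Dxy]].
  by rewrite negbK; exists y.
split; first by case/difference_adjP: Dxy.
by apply/forallPn; exists y; rewrite negbK.
Qed.

Lemma coprime_adj x y : x \in G -> y \in G -> x != 1 -> y != 1 ->
  coprime #[x] #[y] -> D x y.
Proof.
move=> Gx Gy x1 y1 co_xy.
have [xt yt] := coprime_cycleM nilG Gx Gy co_xy.
apply/difference_adjP; split=> //; first by apply/cyclic_pairP; exists (x * y).
  apply: contra x1; rewrite -cycle_subG -order_eq1 => /cardSg /gcdn_idPl.
  by rewrite -![#|_|]/(#[_]) (eqP co_xy) => <-.
apply: contra y1; rewrite -cycle_subG -order_eq1 => /cardSg /gcdn_idPr.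
by rewrite -![#|_|]/(#[_]) (eqP co_xy) => <-.
Qed.

(** The product of [a] and the p'-part of [x] generates a cyclic group containing both [a] and
    [x]. *)
Lemma primary_adj p a x : x \in G -> a \in G -> p.-elt a ->
  x.`_p \in <[a]> -> a \notin <[x]> -> ~~ p.-elt x -> D x a.
Proof.
move=> Gx Ga p_a xpa nax npx.
have Gx' : x.`_p^' \in G by apply: mem_cycle_trans (cycle_constt _ _) Gx.
have co : coprime #[a] #[x.`_p^'] := pnat_coprime p_a (p_elt_constt _ _).
have [at_ x't] := coprime_cycleM nilG Ga Gx' co.
apply/difference_adjP; split=> //; last by apply: contra npx => /cycle_p_elt->.
apply/cyclic_pairP; exists (a * x.`_p^') => //.
by rewrite -[X in X \in _](consttC p) groupM // (mem_cycle_trans xpa).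
Qed.

(** Some primary part of a neighbour [y] escapes [<[x]>] and serves as [a]: p-elements of a common
    cyclic group are comparable, so the p-part of [x] lies in [<[a]>]. A p-element [x] would then
    lie in [<[y]>]. *)
Lemma vertex_primary x : x \in vset (difference_graph G) ->
  exists p a, [/\ prime p, a \in G, p.-elt a, a \notin <[x]> &
                  x.`_p \in <[a]> /\ ~~ p.-elt x].
Proof.
case/vertexP=> y /difference_adjP[Gx Gy /cyclic_pairP[t xt yt] nxy nyx].
have [p pr_p nypx] := notin_cycle_constt nyx.
have p_y : p.-elt y.`_p by apply: p_elt_constt.
have /mem_cycle_trans ypy := cycle_constt p y.
have /mem_cycle_trans xpx := cycle_constt p x.
have xpy : x.`_p \in <[y.`_p]>.
  have := p_elt_comparable (xpx _ xt) (ypy _ yt) (p_elt_constt p x) p_y.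
  case/orP=> // /mem_cycle_trans/(_ (cycle_constt _ _)).
  by rewrite (negPf nypx).
exists p, y.`_p; split=> //; first exact: ypy Gy.
split=> //; apply: contra nxy => p_x.
by rewrite -(constt_p_elt p_x) (mem_cycle_trans xpy) // cycle_constt.
Qed.

Lemma distinct_primes_adj p q a b : a \in G -> b \in G -> a != 1 -> b != 1 ->
  p.-elt a -> q.-elt b -> q != p -> D a b.
Proof.
move=> Ga Gb a1 b1 p_a q_b nqp; apply: coprime_adj => //.
by apply: (pnat_coprime p_a); apply: pi_pnat q_b _; rewrite !inE.
Qed.

Lemma vertex_in x : x \in vset (difference_graph G) -> x \in G.
Proof. by case/vertexP=> y /difference_adjP[]. Qed.

Lemma notin_cycle_neq1 a x : a \notin <[x]> -> a != 1.
Proof. by apply: contraNneq => ->; apply: group1. Qed.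

(** * Upper bounds 4 and 3 on distances *)

Lemma diff_walk4 x y :
  x \in vset (difference_graph G) -> y \in vset (difference_graph G) ->
  exists2 k, k <= 4 & walk (difference_graph G) k x y.
Proof.
move=> Vx Vy; have [Gx Gy] := (vertex_in Vx, vertex_in Vy).
have [p [a [pr_p Ga p_a nax [xa npx]]]] := vertex_primary Vx.
have [q [b [pr_q Gb q_b nby [yb nqy]]]] := vertex_primary Vy.
have Dxa : D x a by apply: primary_adj xa _ _.
have Dby : D b y by rewrite adj_sym; apply: primary_adj yb _ _.
have [a1 b1] := (notin_cycle_neq1 nax, notin_cycle_neq1 nby).
have [eq_qp|nqp] := eqVneq q p; last first.
  exists 3 => //.
  by apply: walk3 Dxa (distinct_primes_adj _ _ _ _ p_a q_b nqp) Dby.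
have [r [c [pr_r nrp Gc oc]]] := other_prime npG pr_p.
have c1 : c != 1 := prime_order_neq1 pr_r oc.
have r_c : r.-elt c by rewrite /p_elt oc pnat_id.
exists 4 => //; apply: walk_cons Dxa (walk3 (a := c) _ _ Dby).
  exact: distinct_primes_adj p_a r_c nrp.
by rewrite adj_sym; apply: distinct_primes_adj q_b r_c _; rewrite // eq_qp.
Qed.

Lemma same_prime_walk2 p b x y : ~ Psi_group G -> ~~ cyclic G -> prime p ->
  x \in G -> y \in G -> ~~ p.-elt x ->
  (exists a, [/\ a \in G, p.-elt a, a \notin <[x]> & x.`_p \in <[a]>]) ->
  b \in G -> p.-elt b -> b \notin <[y]> -> y.`_p \in <[b]> ->
  D b y -> #[x.`_p] %| #[y.`_p] -> walk (difference_graph G) 2 x y.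
Proof.
move=> nPsi ncG pr_p Gx Gy npx [a [Ga p_a nax xa]] Gb p_b nby yb Dby dv.
have hallP := nilpotent_pcore_Hall p nilG.
(* In the group generated by the p-part of [y], this generates the subgroup whose order is that of
   the p-part of [x]. *)
pose v := y.`_p ^+ (#[y.`_p] %/ #[x.`_p]).
have vy : v \in <[y.`_p]> by apply: mem_cycle.
have ov : #[x.`_p] = #[v].
  by rewrite [RHS]orderXdiv ?dvdn_div // divnA // mulKn.
have yy : y.`_p \in <[y]> by apply: cycle_constt.
have xx : x.`_p \in <[x]> by apply: cycle_constt.
have Px : x.`_p \in 'O_p(G).
  by rewrite mem_Hall_pcore ?p_elt_constt // (mem_cycle_trans xx).
have Pv : v \in 'O_p(G).
  by rewrite groupX // mem_Hall_pcore ?p_elt_constt // (mem_cycle_trans yy).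
have eq_xv : <[x.`_p]> = <[v]>.
  (* Two distinct subgroups of equal order, non-maximal because of [a] and [b], would make [G] a
     Psi-group. *)
  apply/eqP/idPn => neq; case: nPsi; split=> //.
  exists p, 'O_p(G)%G, x.`_p, v; split; split=> //.
    apply/(max_cyclicPn Px); exists a; split=> //.
      by rewrite mem_Hall_pcore.
    by apply: contra nax => /mem_cycle_trans->.
  apply/(max_cyclicPn Pv); exists b; split=> //.
  - by rewrite mem_Hall_pcore.
  - exact: mem_cycle_trans vy yb.
  apply: contra nby => /mem_cycle_trans/(_ vy)/mem_cycle_trans; exact.
have xy : x.`_p \in <[y.`_p]>.
  by apply: mem_cycle_trans vy; rewrite -eq_xv cycle_id.
apply: walk2 Dby; apply: (primary_adj _ _ p_b _ _ npx) => //.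
  exact: mem_cycle_trans xy yb.
(* A p-element of [<[x]>] is a power of the p-part of [x], hence lies in [<[y]>]; so [b] is not in
   [<[x]>]. *)
apply: contra nby => /(mem_cycle_constt p); rewrite (constt_p_elt p_b) => bx.
by apply: mem_cycle_trans bx (mem_cycle_trans xy yy).
Qed.

Lemma diff_walk3 x y : ~ Psi_group G -> ~~ cyclic G ->
  x \in vset (difference_graph G) -> y \in vset (difference_graph G) ->
  exists2 k, k <= 3 & walk (difference_graph G) k x y.
Proof.
move=> nPsi ncG Vx Vy; have [Gx Gy] := (vertex_in Vx, vertex_in Vy).
have [p [a [pr_p Ga p_a nax [xa npx]]]] := vertex_primary Vx.
have [q [b [pr_q Gb q_b nby [yb nqy]]]] := vertex_primary Vy.
have Dxa : D x a by apply: primary_adj xa _ _.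
have Dby : D b y by rewrite adj_sym; apply: primary_adj yb _ _.
have [a1 b1] := (notin_cycle_neq1 nax, notin_cycle_neq1 nby).
have [eq_qp|nqp] := eqVneq q p; last first.
  exists 3 => //.
  by apply: walk3 Dxa (distinct_primes_adj _ _ _ _ p_a q_b nqp) Dby.
subst q; exists 2 => //.
have /p_natP[i oi] := p_elt_constt p x.
have /p_natP[j oj] := p_elt_constt p y.
have [le_ij|/ltnW le_ji] := leqP i j.
  apply: (@same_prime_walk2 p b) => //; first by exists a.
  by rewrite oi oj dvdn_exp2l.
apply/walk2_sym/(@same_prime_walk2 p a) => //; first by exists b.
  by rewrite adj_sym.
by rewrite oi oj dvdn_exp2l.
Qed.

(** Maximality forces [m != 1]: an element of prime order other than [p] generates a cyclic group
    together with 1, but is not in [<[1]>]. *)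
Lemma p'_max_elt p : prime p -> exists m, [/\ m \in G, p^'.-elt m, m != 1 &
  forall w, w \in G -> p^'.-elt w -> cyclic <<[set m; w]>> -> w \in <[m]>].
Proof.
move=> pr_p; have [m [Gm p'm max_m]] := max_elt_ex p^' G.
exists m; split=> //; apply/eqP=> m1.
have [r [c [pr_r nrp Gc oc]]] := other_prime npG pr_p.
have: c \in <[m]>.
  apply: max_m => //; first by rewrite /p_elt oc pnatE // !inE.
  by apply/cyclic_pairP; exists c; rewrite ?cycle_id // m1 group1.
by rewrite m1 cycle1 inE (negPf (prime_order_neq1 pr_r oc)).
Qed.

(* The elements c * m, with c a p-element and <[m]> maximal among the cyclic
   p'-subgroups, realize the lower bounds on the diameter: a neighbour of c * m
   can only leave <[c * m]> through its p-part. *)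
Section MaximalPrimeToPart.

Variables (p : nat) (m : gT).
Hypotheses (Gm : m \in G) (p'm : p^'.-elt m) (m1 : m != 1).
Hypothesis max_m :
  forall w, w \in G -> p^'.-elt w -> cyclic <<[set m; w]>> -> w \in <[m]>.

Lemma p_p'_commute c : c \in G -> p.-elt c -> commute c m.
Proof.
by move=> Gc p_c; apply: (coprime_commute nilG) => //; apply: pnat_coprime p'm.
Qed.

Lemma mulm_adj c a : c \in G -> p.-elt c -> a \in G -> p.-elt a ->
  c \in <[a]> -> a \notin <[c]> -> D (c * m) a.
Proof.
move=> Gc p_c Ga p_a ca nac.
have [cmp cmp'] := consttM_p (p_p'_commute Gc p_c) p_c p'm.
apply: (primary_adj _ Ga p_a); rewrite ?groupM ?cmp //.
  apply: contra nac => /(mem_cycle_constt p).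
  by rewrite cmp (constt_p_elt p_a).
apply: contra m1 => p_cm; rewrite -cmp'; apply/eqP/constt1P.
by rewrite /p_elt pnatNK.
Qed.

(** Maximality of [m] puts the p'-part of [z] in [<[m]>], so [z] can be outside [<[c * m]>] only if
    its p-part is outside [<[c]>]; comparability of p-elements gives the other membership. *)
Lemma mulm_nbr c z : c \in G -> p.-elt c -> D (c * m) z ->
  c \in <[z.`_p]> /\ z.`_p \notin <[c]>.
Proof.
move=> Gc p_c /difference_adjP[Gcm Gz /cyclic_pairP[t cmt zt] _ nz].
have [cmp cmp'] := consttM_p (p_p'_commute Gc p_c) p_c p'm.
have c_cm : c \in <[c * m]> by rewrite -{1}cmp cycle_constt.
have m_cm : m \in <[c * m]> by rewrite -{1}cmp' cycle_constt.
have /mem_cycle_trans zpz := cycle_constt p z.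
have /mem_cycle_trans zp'z := cycle_constt p^' z.
have z'm : z.`_p^' \in <[m]>.
  apply: max_m; rewrite ?p_elt_constt ?zp'z //.
  by apply/cyclic_pairP; exists t; [apply: mem_cycle_trans cmt | apply: zp'z].
have nzc : z.`_p \notin <[c]>.
  apply: contra nz => zc; rewrite -[z](consttC p) groupM //.
    exact: mem_cycle_trans zc c_cm.
  exact: mem_cycle_trans z'm m_cm.
split=> //.
have ct := mem_cycle_trans c_cm cmt.
have := p_elt_comparable ct (zpz _ zt) p_c (p_elt_constt p z).
by rewrite (negPf nzc) orbF.
Qed.

End MaximalPrimeToPart.

(** * Lower bounds on the diameter *)

Lemma card_ge4 : 4 <= #|gT|.
Proof.
(* The search for distances stops at [#|gT|]; two distinct prime divisors of [#|G|] make room for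
   the bound 4. *)
have [q [c [pr_q _ Gc oc]]] := other_prime npG (isT : prime 2).
have [r [d [pr_r nrq Gd od]]] := other_prime npG pr_q.
have dv : q * r %| #|G|.
  have co_qr : coprime q r by rewrite prime_coprime // dvdn_prime2 // eq_sym.
  by rewrite Gauss_dvd // -[in q %| _]oc -[in r %| _]od !order_dvdG.
apply: leq_trans (leq_mul (prime_gt1 pr_q) (prime_gt1 pr_r)) _.
by apply: leq_trans (dvdn_leq (cardG_gt0 _) dv) (max_card _).
Qed.

(** Every neighbour of [u * m] generates a group containing [u], every neighbour of [v * m] one
    containing [v], and no cyclic group contains both. *)
Lemma Psi_diam_ge4 : Psi_group G -> 4 <= diam (difference_graph G).
Proof.
case=> _ _ _ [p [P [u [v [[pr_p sylP Pu] [Pv neq_uv ouv]]]]]].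
case/(max_cyclicPn Pu)=> a [Pa ua nau] /(max_cyclicPn Pv)[b [Pb vb nbv]].
have pP := pHall_pgroup sylP; have /subsetP sPG := pHall_sub sylP.
have [m [Gm p'm m1 max_m]] := p'_max_elt pr_p.
have [Gu Gv] := (sPG _ Pu, sPG _ Pv).
have [p_u p_v] := (mem_p_elt pP Pu, mem_p_elt pP Pv).
have up z : D (u * m) z -> u \in <[z]>.
  case/(mulm_nbr Gm p'm max_m Gu p_u)=> uz _.
  exact: mem_cycle_trans uz (cycle_constt _ _).
have vp z : D z (v * m) -> v \in <[z]>.
  rewrite adj_sym; case/(mulm_nbr Gm p'm max_m Gv p_v)=> vz _.
  exact: mem_cycle_trans vz (cycle_constt _ _).
have no_t t : u \in <[t]> -> v \in <[t]> -> False.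
  by move=> ut vt; rewrite (eq_cycle_order ut vt ouv) eqxx in neq_uv.
have um : u \in <[u * m]>.
  have [def_u _] := consttM_p (p_p'_commute Gm p'm Gu p_u) p_u p'm.
  by rewrite -{1}def_u cycle_constt.
have vm : v \in <[v * m]>.
  have [def_v _] := consttM_p (p_p'_commute Gm p'm Gv p_v) p_v p'm.
  by rewrite -{1}def_v cycle_constt.
have Dua : D (u * m) a.
  by apply: (mulm_adj Gm p'm m1 Gu p_u (sPG _ Pa) (mem_p_elt pP Pa)).
have Dvb : D (v * m) b.
  by apply: (mulm_adj Gm p'm m1 Gv p_v (sPG _ Pb) (mem_p_elt pP Pb)).
apply: (@diam_ge _ _ _ (u * m) (v * m)) => [|||k].
- exact: card_ge4.
- by apply/vertexP; exists a.
- by apply/vertexP; exists b.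
case: k => [|[|[|[|//]]]] _.
- by rewrite walk0; apply/eqP=> eq_uv; apply: (no_t (u * m)); rewrite // eq_uv.
- by rewrite walk1; apply/negP => /up/no_t; apply.
- rewrite walkS; apply/existsP=> [[z /andP[/up uz]]].
  by rewrite walk1 => /vp /(no_t z uz).
(* Length 3: the adjacent inner vertices [z] and [w] lie in one cyclic group, which would contain
   [u] and [v]. *)
rewrite walkS; apply/existsP=> [[z /andP[/up uz]]].
rewrite walkS => /existsP[w /andP[/difference_adjP[_ _ + _ _]]].
case/cyclic_pairP=> t zt wt.
rewrite walk1 => /vp vw; apply: (no_t t); [exact: mem_cycle_trans zt|].
exact: mem_cycle_trans wt.
Qed.

Lemma diam_ge3 : ~ square_free (exponent G) -> 3 <= diam (difference_graph G).
Proof.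
move=> nsqf; have [e Ge oe] := exponent_witness nilG.
have [p pr_p p2e] : exists2 p, prime p & p ^ 2 %| #[e].
  have [/hasP[p]|/hasPn nop] :=
    boolP (has (fun p => p ^ 2 %| #[e]) (primes #[e])).
    by rewrite mem_primes => /andP[pr_p _] p2e; exists p.
  (* Without such a prime the exponent is square-free: [pdiv d] would be one for any [d] other than
     1. *)
  case: nsqf => d; rewrite oe => d2e; apply/eqP/idPn=> nd1.
  have d2p : pdiv d ^ 2 %| #[e].
    by apply: dvdn_trans d2e; rewrite dvdn_exp2r ?pdiv_dvd.
  have d_gt1 : 1 < d.
    case: d d2e nd1 {d2p} => [|[]] //; rewrite exp0n // dvd0n.
    by rewrite (negPf (lt0n_neq0 (order_gt0 e))).
  suff /nop: pdiv d \in primes #[e] by rewrite d2p.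
  rewrite mem_primes pdiv_prime // order_gt0.
  by apply: dvdn_trans d2p; rewrite dvdn_exp.
pose a := e ^+ (#[e] %/ p ^ 2); pose c := a ^+ p.
have oa : #[a] = (p ^ 2)%N by rewrite orderXdiv ?dvdn_div // divnA // mulKn.
have oc : #[c] = p by rewrite [LHS]orderXdiv oa ?dvdn_exp // mulnK ?prime_gt0.
have p_a : p.-elt a by rewrite /p_elt oa pnatX pnat_id.
have p_c : p.-elt c by rewrite /p_elt oc pnat_id.
have ca : c \in <[a]> by apply: mem_cycle.
have nac : a \notin <[c]>.
  rewrite -cycle_subG; apply/negP=> /subset_leq_card.
  by rewrite -![#|_|]/(#[_]) oa oc leqNgt ltn_Pmull ?prime_gt1 ?prime_gt0.
have Ga : a \in G by rewrite groupX.
have Gc : c \in G by rewrite groupX.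
have c1 : c != 1 := prime_order_neq1 pr_p oc.
have [m [Gm p'm m1 max_m]] := p'_max_elt pr_p.
have [cmp cmp'] := consttM_p (p_p'_commute Gm p'm Gc p_c) p_c p'm.
have c_cm : c \in <[c * m]> by rewrite -{1}cmp cycle_constt.
have m_cm : m \in <[c * m]> by rewrite -{1}cmp' cycle_constt.
have [r [d [pr_r nrp Gd od]]] := other_prime npG pr_p.
have d1 : d != 1 := prime_order_neq1 pr_r od.
have r_d : r.-elt d by rewrite /p_elt od pnat_id.
(* If [p] divided the order of [w], then [c], of order [p], would lie in [<[w]>]. *)
have nbr_p' w : D w c -> p^'.-elt w.
  case/difference_adjP=> _ _ /cyclic_pairP[t wt ct] _; rewrite /p_elt p'natE //.
  by apply: contra; rewrite -{1}oc; apply: mem_cycle_dvd ct wt.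
apply: (@diam_ge _ _ _ (c * m) c).
- exact: leq_trans card_ge4.
- by apply/vertexP; exists a; apply: (mulm_adj Gm p'm m1 Gc p_c).
- by apply/vertexP; exists d; apply: (distinct_primes_adj Gc Gd c1 d1 p_c r_d).
case=> [|[|[|//]]] _.
- by rewrite walk0 -{2}(mulg1 c) (inj_eq (mulgI c)).
- by rewrite walk1; apply/negP => /difference_adjP[_ _ _ _]; rewrite c_cm.
(* The p-part of a neighbour of [c * m] is outside [<[c]>], while that of a neighbour of [c] is
   trivial. *)
rewrite walkS; apply/existsP=> [[w /andP[Dw]]]; rewrite walk1 => /nbr_p' p'w.
have [_] := mulm_nbr Gm p'm max_m Gc p_c Dw.
by rewrite (constt1P p'w) group1.
Qed.

(** A nilpotent group whose Sylow subgroups are all cyclic is cyclic. In a non-cyclic one, a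
    generator [m] of a maximal cyclic subgroup and any [w] outside [<[m]>] are neither equal nor
    adjacent. *)
Lemma diam_ge2 : ~~ cyclic G -> 2 <= diam (difference_graph G).
Proof.
move=> ncG.
have [P /SylowP[p pr_p sylP] ncP] :
    exists2 P : {group gT}, Sylow G P & ~~ cyclic P.
  have: ~~ Zgroup G by apply: contra ncG => /nil_Zgroup_cyclic->.
  by case/forallPn=> P; rewrite negb_imply => /andP[]; exists P.
have pP := pHall_pgroup sylP; have /subsetP sPG := pHall_sub sylP.
have [m [Pm _ max_m]] := max_elt_ex p P.
have [w Pw nwm] : exists2 w, w \in P & w \notin <[m]>.
  apply/subsetPn; apply: contra ncP => sPm; apply: cyclicS sPm _.
  exact: cycle_cyclic.
have ncmw : ~~ cyclic <<[set m; w]>>.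
  by apply: contra nwm; apply: max_m; rewrite // (mem_p_elt pP).
have [r [c [pr_r nrp Gc oc]]] := other_prime npG pr_p.
have c1 : c != 1 := prime_order_neq1 pr_r oc.
have r_c : r.-elt c by rewrite /p_elt oc pnat_id.
have vert z : z \in P -> z != 1 -> z \in vset (difference_graph G).
  move=> Pz z1; apply/vertexP; exists c.
  by apply: distinct_primes_adj (sPG _ Pz) Gc z1 c1 (mem_p_elt pP Pz) r_c nrp.
apply: (@diam_ge _ _ _ m w).
- exact: leq_trans card_ge4.
- apply: vert => //; apply: contraNneq ncmw => ->.
  by apply/cyclic_pairP; exists w; rewrite ?group1 ?cycle_id.
- apply: vert => //; apply: contraNneq ncmw => ->.
  by apply/cyclic_pairP; exists m; rewrite ?group1 ?cycle_id.
case=> [|[|//]] _.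
  by rewrite walk0; apply: contraNneq nwm => <-; apply: cycle_id.
by rewrite walk1; apply: contra ncmw => /difference_adjP[].
Qed.

(** * Upper bound 2 for square-free exponent *)

Lemma square_free_p_elt p a x : square_free (exponent G) ->
  prime p -> a \in G -> p.-elt a -> x \in <[a]> -> a \notin <[x]> -> x = 1.
Proof.
move=> sqf pr_p Ga p_a xa nax; have /p_natP[n oa] := p_a.
have oxa : #[x] %| #[a] by apply: order_dvdG.
(* Square-freeness, applied to [p], leaves only 1 and [p] as orders of [a]. *)
have n_le1 : n <= 1.
  rewrite leqNgt; apply/negP=> n_gt1.
  have p1 : p = 1%N.
    by apply: sqf; apply: dvdn_trans (dvdn_exponent Ga); rewrite oa dvdn_exp2l.
  by rewrite p1 in pr_p.
apply/eqP; rewrite -order_eq1; apply: contraR nax => ox1.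
apply: mem_cycle_dvd (cycle_id a) xa _; move: oxa; rewrite oa.
case: n n_le1 {oa} => [|[|//]] _; first by rewrite dvd1n.
case/primeP: pr_p => _ /[apply]; rewrite (negPf ox1) => /eqP->.
by rewrite expn1.
Qed.

(** The cyclic group generated by [x] times the p-part of [y] contains both vertices. The product
    has a nontrivial p-part, unlike [x], and a trivial r-part, unlike [x]. *)
Lemma mixed_adj p q r x y : x \in G -> y \in G ->
  p^'.-elt x -> q^'.-elt y -> ~~ p^'.-elt y -> prime r ->
  r %| #[x] -> r %| #[y] -> D x (x.`_q * y.`_p).
Proof.
move=> Gx Gy p'x q'y np'y pr_r rx ry.
have r'N (z : gT) : r %| #[z] -> ~~ r^'.-elt z.
  by move=> rz; rewrite /p_elt p'natE // rz.
have nrp : r != p by apply: contraTneq p'x => <-; apply: r'N.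
have nrq : r != q by apply: contraTneq q'y => <-; apply: r'N.
have Gyp : y.`_p \in G := mem_cycle_trans (cycle_constt p y) Gy.
have p_yp := p_elt_constt p y; have q_xq := p_elt_constt q x.
have co : coprime #[x] #[y.`_p] by rewrite coprime_sym; apply: pnat_coprime p'x.
have [xt yt] := coprime_cycleM nilG Gx Gyp co.
have xqt : x.`_q \in <[x * y.`_p]> := mem_cycle_trans (cycle_constt q x) xt.
have cxy : commute x.`_q y.`_p.
  by apply: (centsP (cycle_abelian (x * y.`_p))).
have zpE : (x.`_q * y.`_p).`_p = y.`_p.
  have p'xq : p^'.-elt x.`_q := cycle_p_elt (cycle_constt q x) p'x.
  by rewrite consttM // (constt1P p'xq) mul1g (constt_p_elt p_yp).
have zr1 : (x.`_q * y.`_p).`_r = 1.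
  have r'xq : r^'.-elt x.`_q by apply: pi_pnat q_xq _; rewrite !inE eq_sym.
  have r'yp : r^'.-elt y.`_p by apply: pi_pnat p_yp _; rewrite !inE eq_sym.
  by rewrite consttM // (constt1P r'xq) (constt1P r'yp) mulg1.
apply/difference_adjP; split=> //.
- by rewrite groupM // (mem_cycle_trans (cycle_constt q x)).
- by apply/cyclic_pairP; exists (x * y.`_p); rewrite // groupM.
- apply: contra (r'N _ rx) => /(mem_cycle_constt r); rewrite zr1 cycle1 inE.
  by move/eqP=> xr1; apply/constt1P.
apply: contra np'y => /(mem_cycle_constt p).
by rewrite zpE (constt1P p'x) cycle1 inE => /eqP yp1; apply/constt1P.
Qed.

Lemma diff_walk2 x y : square_free (exponent G) ->
  x \in vset (difference_graph G) -> y \in vset (difference_graph G) ->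
  exists2 k, k <= 2 & walk (difference_graph G) k x y.
Proof.
move=> sqf Vx Vy; have [Gx Gy] := (vertex_in Vx, vertex_in Vy).
have [p [a [pr_p Ga p_a nax [xa npx]]]] := vertex_primary Vx.
have [q [b [pr_q Gb q_b nby [yb nqy]]]] := vertex_primary Vy.
have p'x : p^'.-elt x.
  apply/constt1P/(square_free_p_elt sqf pr_p Ga p_a xa).
  by apply: contra nax => /mem_cycle_trans->//; apply: cycle_constt.
have q'y : q^'.-elt y.
  apply/constt1P/(square_free_p_elt sqf pr_q Gb q_b yb).
  by apply: contra nby => /mem_cycle_trans->//; apply: cycle_constt.
have neq1 r (z : gT) : ~~ r.-elt z -> z != 1.
  by apply: contraNneq => ->; rewrite /p_elt order1.
have [x1 y1] := (neq1 _ _ npx, neq1 _ _ nqy).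
have [a1 b1] := (notin_cycle_neq1 nax, notin_cycle_neq1 nby).
have near r (c z : gT) : r.-elt c -> r^'.-elt z -> coprime #[z] #[c].
  by move=> r_c r'z; rewrite coprime_sym; apply: pnat_coprime r'z.
(* If [p] divides neither order, [a] is a common neighbour; in the next case [b] is one, with [q]
   for [p]. *)
have [p'y|np'y] := boolP (p^'.-elt y).
  exists 2 => //; apply: (walk2 (z := a)).
    by apply: coprime_adj => //; apply: near p_a p'x.
  by rewrite adj_sym; apply: coprime_adj => //; apply: near p_a p'y.
have [q'x|nq'x] := boolP (q^'.-elt x).
  exists 2 => //; apply: (walk2 (z := b)).
    by apply: coprime_adj => //; apply: near q_b q'x.
  by rewrite adj_sym; apply: coprime_adj => //; apply: near q_b q'y.
have [co_xy|nco_xy] := boolP (coprime #[x] #[y]).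
  by exists 1%N => //; rewrite walk1; apply: coprime_adj.
have [r pr_r /andP[rx ry]] : exists2 r, prime r & (r %| #[x]) && (r %| #[y]).
  exists (pdiv (gcdn #[x] #[y])); last by rewrite -dvdn_gcd pdiv_dvd.
  apply: pdiv_prime; move: nco_xy; rewrite /coprime.
  by case: gcdn (gcdn_gt0 #[x] #[y]) => [|[]] //; rewrite order_gt0.
(* Now [q] divides the order of [x], [p] that of [y], and [r] both. *)
exists 2 => //; apply: (walk2 (z := x.`_q * y.`_p)).
  exact: mixed_adj pr_r rx ry.
rewrite adj_sym.
(* Swapping the factors reduces to the previous adjacency with [x], [y] and [p], [q] exchanged. *)
have -> : x.`_q * y.`_p = y.`_p * x.`_q.
  apply: (coprime_commute nilG).
  - exact: mem_cycle_trans (cycle_constt _ _) Gx.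
  - exact: mem_cycle_trans (cycle_constt _ _) Gy.
  rewrite coprime_sym; apply: near (p_elt_constt _ _) _.
  exact: cycle_p_elt (cycle_constt _ _) q'y.
exact: mixed_adj pr_r ry rx.
Qed.

End DifferenceGraph.

Theorem theorem5p8 (gT : finGroupType) (G : {group gT})
    (nilG : nilpotent G) (ncycG : ~~ cyclic G) (npG : not_pgroup G) :
  [/\ connected_graph (difference_graph G),
      square_free (exponent G) -> diam (difference_graph G) = 2,
      Psi_group G -> diam (difference_graph G) = 4
    & ~ square_free (exponent G) -> ~ Psi_group G ->
        diam (difference_graph G) = 3].
Proof.
have ge2 := diam_ge2 nilG npG ncycG.
have le4 := diam_le (diff_walk4 nilG npG).
split.
- split=> [|x y Vx Vy]; last first.
    by have [k _ /walk_connect] := diff_walk4 nilG npG Vx Vy.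
  (* An empty vertex set would give diameter 0. *)
  by apply: contraTneq ge2 => V0; rewrite /diam V0 big_set0.
- move=> sqf; apply/eqP; rewrite eqn_leq ge2 andbT.
  by apply: diam_le => x y; apply: diff_walk2.
- by move=> /(Psi_diam_ge4 nilG npG) ge4; apply/eqP; rewrite eqn_leq le4.
move=> nsqf nPsi; apply/eqP; rewrite eqn_leq (diam_ge3 nilG npG nsqf) andbT.
by apply: diam_le => x y; apply: diff_walk3.
Qed.
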